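(* Let $M,N$ be coprime positive integers and let $s$ be an integer with $0\le s\le 2N-1$. Let $z(l)$ be the weight function of the extremely sparse co-prime array with sub-arrays $P_1=\{2Mn: 0\le n\le N-1\}$ and $P_2=\{2Nm+s: 0\le m\le M-1\}$. 1. If $s$ is odd: (a) $z(l)=N-n$ for $l=\pm 2Mn$, $1\le n\le N-1$; (b) $z(l)=M-m$ for $l=\pm 2Nm$, $1\le m\le M-1$; (c) $z(l)=M+N$ for $l=0$; (d) $z(l)=2$ for $l\in\mathcal{L}_p\setminus\{0\}$; (e) $z(l)=1$ for $l\in\mathcal{L}_{np}=\mathcal{L}_C\setminus\mathcal{L}_p$. 2. If $s$ is even: (a) $z(l)=N-n$ for $l=\pm 2Mn$, $1\le n\le N-1$; (b) $z(l)=M-m$ for $l=\pm 2Nm$, $1\le m\le M-1$; (c) $z(l)=M+N-1$ for $l=0$; (d) $z(l)=2$ for $l\in\mathcal{L}_p\setminus\mathcal{L}_S$; (e) $z(l)=1$ for $l\in(\mathcal{L}_C\setminus\mathcal{L}_p)\setminus\mathcal{L}_S$.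
   Context: The extremely sparse co-prime array (ExSCA, sparsity constant 2) with parameters $(M,N,s)$ consists of two sub-arrays of integer positions (Nyquist distance $d=1$): $P_1=\{2Mn : n\in\mathbb{Z},\,0\le n\le N-1\}$ and $P_2=\{2Nm+s : m\in\mathbb{Z},\,0\le m\le M-1\}$. Weight function: $z(l)$ is the number of contributors available for autocorrelation estimation at difference value (lag) $l$, i.e. the number of ordered pairs $(a,b)$ of elements of the combined array $P_1\cup P_2$ (an element common to both sub-arrays being counted once) with $a-b=l$. Self difference sets: $\mathcal{L}^+_{SM}=\{2Mn: 0\le n\le N-1\}$, $\mathcal{L}^+_{SN}=\{2Nm: 0\le m\le M-1\}$, $\mathcal{L}^-_{SM}=-\mathcal{L}^+_{SM}$, $\mathcal{L}^-_{SN}=-\mathcal{L}^+_{SN}$, $\mathcal{L}_S=\mathcal{L}^+_{SM}\cup\mathcal{L}^+_{SN}\cup\mathcal{L}^-_{SM}\cup\mathcal{L}^-_{SN}$. Cross difference sets: $\mathcal{L}^+_C=\{2Mn-(2Nm+s): 0\le n\le N-1,\ 0\le m\le M-1\}$, $\mathcal{L}^-_C=-\mathcal{L}^+_C$, $\mathcal{L}_C=\mathcal{L}^+_C\cup\mathcal{L}^-_C$. The mirror-pair set $\mathcal{L}_p$ (elements of $\mathcal{L}^+_C$ whose negative also lies in $\mathcal{L}^+_C$) is the set of all $l=2Mn_1-(2Nm_1+s)$ with $n_1\in[0,N-1]$, $m_1\in[0,M-1]$ such that either there exist $n_2\in[0,N-1]$, $m_2\in[0,M-1]$ with $n_1+n_2\ne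 0$ and $M=\frac{N(m_1+m_2)+s}{n_1+n_2}$, or $n_1=m_1=s=0$. *)

(* Defs.v *)
From mathcomp Require Import all_boot all_order all_algebra finmap.

Set Implicit Arguments.
Unset Strict Implicit.
Unset Printing Implicit Defensive.

Import Order.TTheory GRing.Theory Num.Theory.

Local Open Scope fset_scope.
Local Open Scope ring_scope.

Definition P1 (M N : nat) : {fset int} :=
  [fset 2 * M%:Z * n%:Z | n in iota 0 N].

Definition P2 (M N : nat) (s : int) : {fset int} :=
  [fset 2 * N%:Z * m%:Z + s | m in iota 0 M].

(* An element common to both sub-arrays occurs once in this union. *)
Definition ExSCA (M N : nat) (s : int) : {fset int} := P1 M N `|` P2 M N s.

(* Weight function z(l): number of ordered pairs of sensors with difference l. *)
Definition weight (M N : nat) (s l : int) : nat :=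
  #|` [fset p in ExSCA M N s `*` ExSCA M N s | p.1 - p.2 == l]|.

Definition fset_opp (A : {fset int}) : {fset int} := [fset - l | l in A].

Definition LSM_pos (M N : nat) : {fset int} :=
  [fset 2 * M%:Z * n%:Z | n in iota 0 N].

Definition LSN_pos (M N : nat) : {fset int} :=
  [fset 2 * N%:Z * m%:Z | m in iota 0 M].

Definition LSM_neg (M N : nat) : {fset int} := fset_opp (LSM_pos M N).

Definition LSN_neg (M N : nat) : {fset int} := fset_opp (LSN_pos M N).

Definition LS (M N : nat) : {fset int} :=
  LSM_pos M N `|` LSN_pos M N `|` LSM_neg M N `|` LSN_neg M N.

Definition cross_diff (M N : nat) (s : int) (n m : nat) : int :=
  2 * M%:Z * n%:Z - (2 * N%:Z * m%:Z + s).

Definition LC_pos (M N : nat) (s : int) : {fset int} :=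
  [fset cross_diff M N s n m | n in iota 0 N, m in iota 0 M].

Definition LC_neg (M N : nat) (s : int) : {fset int} :=
  fset_opp (LC_pos M N s).

Definition LC (M N : nat) (s : int) : {fset int} := LC_pos M N s `|` LC_neg M N s.

(* The quotient (N (m1 + m2) + s) / (n1 + n2) is taken in the rationals. *)
Definition mirror_cond (M N : nat) (s : int) (n1 m1 : nat) : bool :=
  [exists n2 : 'I_N, exists m2 : 'I_M,
     ((n1 + n2)%N != 0%N) &&
     (M%:R == (N%:R * (m1 + m2)%:R + s%:~R) / (n1 + n2)%:R :> rat)]
  || [&& n1 == 0%N, m1 == 0%N & s == 0].

Definition Lp (M N : nat) (s : int) : {fset int} :=
  [fset cross_diff M N s n m | n in iota 0 N, m in iota 0 M
                             & mirror_cond M N s n m].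

Definition Lnp (M N : nat) (s : int) : {fset int} := LC M N s `\` Lp M N s.

(* Main.v *)
(* Since 0 <= s < 2N, the sub-arrays are P1 = {x in [0, 2MN) : 2M | x} and
   P2 = {x in [0, 2MN) : 2N | x - s}.  Hence an element of P2 divisible by 2M
   already lies in P1, and vice versa: a pair of sensors at distance 2Mn lies
   in P1, one at distance 2Nm lies in P2, whatever the parity of s.  By the
   Chinese remainder theorem P1 and P2 meet in exactly one point when s is even
   and in none when s is odd, and a lag l is a difference of an element of P1
   and an element of P2 in at most one way.  A lag outside the self difference
   set thus has one contributor for each of l, -l lying in LC_pos; and Lp
   consists of the l with both l and -l in LC_pos. *)
Require Import Defs.
From mathcomp Require Import all_boot all_order all_algebra finmap.
From mathcomp Require Import zify ring.

Set Implicit Arguments.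
Unset Strict Implicit.
Unset Printing Implicit Defensive.

Import Order.TTheory GRing.Theory Num.Theory.

Local Open Scope fset_scope.
Local Open Scope ring_scope.

(** * Finite arithmetic progressions of integers *)

Definition progression (d : int) (b : nat) (s : int) : {fset int} :=
  [fset d * k%:Z + s | k in iota 0 b].

Lemma progressionP (d : int) (b : nat) (s x : int) :
  reflect (exists2 k, (k < b)%N & x = d * k%:Z + s) (x \in progression d b s).
Proof.
apply: (iffP (imfsetP _ _ _ _)) => [[k /= kb ->]|[k kb ->]]; exists k => //.
  by move: kb; rewrite mem_iota.
by rewrite /= mem_iota.
Qed.

(** The bound on [s] turns the index range into the window [[0, d * b)], which is free of [s]. Hence
    [P1] and [P2] share the window [[0, 2MN)]. *)
Lemma mem_progression (d : int) (b : nat) (s x : int) : 0 <= s < d ->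
  (x \in progression d b s) = (0 <= x < d * b%:Z) && (d %| x - s)%Z.
Proof.
move=> /andP[s0 sd]; apply/progressionP/andP => [[k kb ->]|[/andP[x0 xb] /dvdzP[q xq]]].
  by split; [nia | rewrite addrK dvdz_mulr].
have q0 : 0 <= q by nia.
by exists `|q|%N; nia.
Qed.

Lemma card_progression (d : int) (b : nat) (s : int) :
  0 < d -> #|` progression d b s| = b.
Proof.
move=> d0; rewrite card_imfset /=; last by move=> i j /addIr; nia.
by rewrite undup_id ?size_iota ?iota_uniq.
Qed.

Lemma sub_progression (d : int) (b : nat) (s x y : int) :
  x \in progression d b s -> y \in progression d b s ->
  (x - y \in progression d b 0) || (- (x - y) \in progression d b 0).
Proof.
move=> /progressionP[i ib ->] /progressionP[j jb ->].
case: (leqP j i) => ij; apply/orP; [left|right]; apply/progressionP.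
  by exists (i - j)%N; [lia | rewrite -subzn //; ring].
by exists (j - i)%N; [lia | rewrite -subzn 1?ltnW //; ring].
Qed.

(** * Sub-arrays and self differences as progressions *)

Lemma P1E (M N : nat) : P1 M N = progression (2 * M%:Z) N 0.
Proof.
by apply/fsetP => x; apply/imfsetP/imfsetP => -[k /= kN ->]; exists k; rewrite ?addr0.
Qed.

Lemma mem_P1 (M N : nat) (x : int) : (0 < M)%N ->
  (x \in P1 M N) = (0 <= x < 2 * M%:Z * N%:Z) && (2 * M%:Z %| x)%Z.
Proof. by move=> M0; rewrite P1E mem_progression ?subr0 //; lia. Qed.

Lemma mem_P2 (M N : nat) (s x : int) : 0 <= s < 2 * N%:Z ->
  (x \in P2 M N s) = (0 <= x < 2 * M%:Z * N%:Z) && (2 * N%:Z %| x - s)%Z.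
Proof. by move=> sN; rewrite mem_progression // mulrAC. Qed.

Lemma mem_fset_opp (A : {fset int}) (x : int) : (x \in fset_opp A) = (- x \in A).
Proof.
apply/imfsetP/idP => [[y /= yA ->]|xA]; first by rewrite opprK.
by exists (- x); rewrite //= opprK.
Qed.

Lemma mem_LS (M N : nat) (l : int) :
  (l \in LS M N) =
  [|| l \in progression (2 * M%:Z) N 0, - l \in progression (2 * M%:Z) N 0,
      l \in progression (2 * N%:Z) M 0 | - l \in progression (2 * N%:Z) M 0].
Proof.
(* [LSN_pos M N] is [P1 N M] up to conversion. *)
have N0 : LSN_pos M N = progression (2 * N%:Z) M 0 by exact: P1E.
rewrite !in_fsetU !mem_fset_opp N0 [LSM_pos M N]P1E.
by rewrite -!orbA (orbCA (l \in progression (2 * N%:Z) M 0)).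
Qed.

(** * The weight as a count of single sensors *)

Lemma weightE (M N : nat) (s l : int) :
  weight M N s l = #|` [fset x in ExSCA M N s | x - l \in ExSCA M N s]|.
Proof.
rewrite /weight; set A := ExSCA _ _ _.
have -> : [fset p in A `*` A | p.1 - p.2 == l] =
          [fset (x, x - l) | x in [fset x in A | x - l \in A]].
  apply/fsetP => -[x y]; rewrite !inE /=; apply/idP/imfsetP.
    move=> /andP[/andP[xA yA] /eqP <-]; exists x; last by rewrite subKr.
    by rewrite !inE /= xA subKr.
  case=> z; rewrite !inE /= => /andP[zA zlA] [-> ->].
  by rewrite zA zlA subKr eqxx.
by rewrite card_imfset //= => x y [].
Qed.

(** Translation by [- l] swaps the two ends of a contributing pair. *)
Lemma weightN (M N : nat) (s l : int) : weight M N s (- l) = weight M N s l.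
Proof.
rewrite !weightE; set A := ExSCA _ _ _.
have -> : [fset x in A | x - - l \in A] =
          [fset x - l | x in [fset x in A | x - l \in A]].
  apply/fsetP => x; rewrite !inE /= opprK; apply/andP/imfsetP.
    by case=> xA xlA; exists (x + l); rewrite ?inE /= addrK // xA xlA.
  by case=> y; rewrite !inE /= => /andP[yA ylA] ->; rewrite subrK.
by rewrite card_imfset //=; exact: addIr.
Qed.

(** * Cross differences and mirror pairs *)

Lemma LC_posP (M N : nat) (s l : int) :
  reflect (exists n m, [/\ (n < N)%N, (m < M)%N & l = cross_diff M N s n m])
          (l \in LC_pos M N s).
Proof.
apply: (iffP (imfset2P _ _ _ _ _)) => [[n /= nN [m /= mM ->]]|[n [m [nN mM ->]]]].
  by exists n, m; move: nN mM; rewrite !mem_iota.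
by exists n; rewrite /= ?mem_iota //; exists m; rewrite /= ?mem_iota.
Qed.

Lemma mem_LC_pos (M N : nat) (s l : int) :
  reflect (exists2 x, x \in P1 M N & x - l \in P2 M N s) (l \in LC_pos M N s).
Proof.
apply: (iffP (LC_posP _ _ _ _)) => [[n [m [nN mM ->]]]|[x]].
  exists (2 * M%:Z * n%:Z); first by apply/imfsetP; exists n; rewrite //= mem_iota.
  by apply/progressionP; exists m; rewrite // /cross_diff; ring.
rewrite P1E => /progressionP[n nN ->] /progressionP[m mM E].
by exists n, m; split=> //; rewrite /cross_diff -E; ring.
Qed.

Lemma eq_quotient (M N a b : nat) (s : int) : b != 0%N ->
  (M%:R == (N%:R * a%:R + s%:~R) / b%:R :> rat) =
  (M%:Z * b%:Z == N%:Z * a%:Z + s).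
Proof.
move=> b0; rewrite -[RHS](inj_eq (@intr_inj rat)) intrD !intrM.
have b0' : b%:R != 0 :> rat by rewrite pnatr_eq0.
by rewrite -[LHS](inj_eq (mulIf b0')) mulfVK.
Qed.

(** Equating [- cross_diff n1 m1] with [cross_diff n2 m2] gives [M (n1 + n2) = N (m1 + m2) + s]. If
    [n1 + n2 = 0], the nonnegative terms on the right all vanish, which is the degenerate
    disjunct. *)
Lemma mirror_condP (M N : nat) (s : int) (n1 m1 : nat) :
  (0 < M)%N -> (0 < N)%N -> 0 <= s ->
  mirror_cond M N s n1 m1 = (- cross_diff M N s n1 m1 \in LC_pos M N s).
Proof.
move=> M0 N0 s0; apply/idP/LC_posP; rewrite /cross_diff.
  case/orP=> [/existsP[n2 /existsP[m2 /andP[nz]]]|/and3P[/eqP-> /eqP-> /eqP->]].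
    by rewrite eq_quotient // => /eqP E; exists n2, m2; split=> //; lia.
  by exists 0%N, 0%N; split=> //; lia.
case=> n2 [m2 [nN mM E]]; apply/orP.
have [nz|nz] := eqVneq (n1 + n2)%N 0%N; last first.
  left; apply/existsP; exists (Ordinal nN); apply/existsP; exists (Ordinal mM).
  by rewrite eq_quotient nz //=; apply/eqP; lia.
by right; have [-> n20] : n1 = 0%N /\ n2 = 0%N; [lia | move: E; rewrite n20; nia].
Qed.

Lemma mem_Lp (M N : nat) (s l : int) :
  (0 < M)%N -> (0 < N)%N -> 0 <= s ->
  (l \in Lp M N s) = (l \in LC_pos M N s) && (- l \in LC_pos M N s).
Proof.
move=> M0 N0 s0; apply/imfset2P/andP.
  case=> n /= nN [m]; rewrite !inE /= => /andP[mM mc] ->.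
  by rewrite -mirror_condP // mc; split=> //; apply/imfset2P; exists n => //; exists m.
case=> /imfset2P[n /= nN [m /= mM ->]] mc; exists n => //; exists m => //.
by rewrite !inE /= mM mirror_condP.
Qed.

Lemma mem_LC (M N : nat) (s l : int) :
  (l \in LC M N s) = (l \in LC_pos M N s) || (- l \in LC_pos M N s).
Proof. by rewrite in_fsetU mem_fset_opp. Qed.

(** Self differences are even, while cross differences have the parity of [s]. *)
Lemma LC_odd_notin_LS (M N : nat) (s l : int) : ~~ (2 %| s)%Z -> l \in LC M N s -> l \notin LS M N.
Proof.
move=> s2 lC; apply: contra s2 => lS.
have l2 : (2 %| l)%Z.
  by case/or4P: (etrans (esym (mem_LS M N l)) lS) => /progressionP[k _ E];
    apply/dvdzP; first [exists (M%:Z * k%:Z); lia | exists (- (M%:Z * k%:Z)); lia |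
                        exists (N%:Z * k%:Z); lia | exists (- (N%:Z * k%:Z)); lia].
move: lC l2; rewrite mem_LC => /orP[] /LC_posP[n [m [_ _ E]]] /dvdzP[q Eq];
  apply/dvdzP; move: E; rewrite /cross_diff Eq => E.
  by exists (M%:Z * n%:Z - N%:Z * m%:Z - q); lia.
by exists (M%:Z * n%:Z - N%:Z * m%:Z + q); lia.
Qed.

(** * Lags inside one progression, and lag zero *)

Lemma card_shift_progression (A : {fset int}) (d : int) (b k : nat) (s : int) :
  0 < d -> progression d b s `<=` A ->
  (forall x y, x \in A -> y \in A -> x - y = d * k%:Z ->
     (x \in progression d b s) && (y \in progression d b s)) ->
  #|` [fset x in A | x - d * k%:Z \in A]| = (b - k)%N.
Proof.
move=> d0 /fsubsetP sub closed.
(* By [closed], both ends of a contributing pair are terms of the progression. The larger ends are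
   the terms from index [k] on. *)
rewrite -[RHS](card_progression (b - k) (d * k%:Z + s) d0); congr #|` _|.
apply/fsetP => x; rewrite !inE /=; apply/andP/progressionP => [[xA yA]|[i ib ->]].
  have /andP[/progressionP[i ib xE] /progressionP[j jb yE]] :=
    closed _ _ xA yA (subKr _ _).
  have ij : i%:Z = j%:Z + k%:Z.
    by apply: (mulfI (lt0r_neq0 d0)); move: yE; rewrite xE; lia.
  by exists j; [lia | rewrite xE ij; ring].
by split; apply/sub/progressionP; [exists (i + k)%N|exists i]; lia.
Qed.

Lemma weight0 (M N : nat) (s : int) : (0 < M)%N -> (0 < N)%N ->
  weight M N s 0 = (M + N - #|` P1 M N `&` P2 M N s|)%N.
Proof.
move=> M0 N0; rewrite weightE; set A := ExSCA _ _ _.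
have -> : [fset x in A | x - 0 \in A] = A.
  by apply/fsetP => x; rewrite !inE /= subr0 andbb.
by rewrite cardfsU P1E !card_progression ?(addnC M) //; lia.
Qed.

(** Elements of [P1] are even; those of [P2] have the parity of [s]. *)
Lemma P1_P2_odd (M N : nat) (s : int) : (0 < M)%N -> 0 <= s < 2 * N%:Z ->
  ~~ (2 %| s)%Z -> P1 M N `&` P2 M N s = fset0.
Proof.
move=> M0 sN s2; apply/fsetP => x; rewrite inE mem_P1 // mem_P2 // in_fset0.
apply/negP => /andP[/andP[_ /dvdzP[a Ea]] /andP[_ /dvdzP[b Eb]]].
by case/negP: s2; apply/dvdzP; exists (a * M%:Z - b * N%:Z); lia.
Qed.

(** * Counting contributors in a coprime array *)

Section Array.
Variables (M N : nat) (s : int).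
Hypotheses (M0 : (0 < M)%N) (N0 : (0 < N)%N) (coMN : coprime M N).
Hypothesis sN : 0 <= s < 2 * N%:Z.

(** Uniqueness in the Chinese remainder theorem: by coprimality the lcm of [2M] and [2N] is [2MN],
    the length of the window. *)
Lemma dvdz_eq_period (x y : int) :
  0 <= x < 2 * M%:Z * N%:Z -> 0 <= y < 2 * M%:Z * N%:Z ->
  (2 * M%:Z %| x - y)%Z -> (2 * N%:Z %| x - y)%Z -> x = y.
Proof.
move=> xb yb /dvdzP[q Eq] dN; apply/eqP; rewrite -subr_eq0 Eq.
have : (2 * N%:Z %| 2 * (q * M%:Z))%Z by move: dN; rewrite Eq; congr (_ %| _)%Z; ring.
(* The common factor 2 is cancelled first, since only [M] and [N] are coprime. Then [N] divides [q],
   so [x - y] is a multiple of [2MN] smaller than [2MN] in absolute value. *)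
rewrite dvdz_mul2l //= Gauss_dvdzl; last by rewrite coprimezE /= coprime_sym.
by move=> /dvdzP[r Er]; move: Eq; rewrite Er => Eq; have : r = 0; [nia | move=> ->; lia].
Qed.

(** The two sub-arrays fill the same window, so only the congruence separates them. *)
Lemma P1_in_P2 (x : int) : x \in P1 M N -> (2 * N%:Z %| x - s)%Z -> x \in P2 M N s.
Proof. by rewrite mem_P1 // mem_P2 // => /andP[-> _] ->. Qed.

Lemma P2_in_P1 (x : int) : x \in P2 M N s -> (2 * M%:Z %| x)%Z -> x \in P1 M N.
Proof. by rewrite mem_P1 // mem_P2 // => /andP[-> _] ->. Qed.

Lemma weight_mulM (n : nat) : (0 < n < N)%N ->
  weight M N s (2 * M%:Z * n%:Z) = (N - n)%N.
Proof.
move=> nN; rewrite weightE.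
apply: (@card_shift_progression _ _ _ _ 0); rewrite -?P1E; first by lia.
  exact: fsubsetUl.
move=> x y /fsetUP[xP|xP] /fsetUP[yP|yP] E.
- by rewrite xP.
(* In a mixed pair the end taken from [P2] is also a multiple of [2M]. *)
- rewrite xP (P2_in_P1 yP) //.
  have -> : y = x - 2 * M%:Z * n%:Z by lia.
  by move: xP; rewrite mem_P1 // => /andP[_ dx]; rewrite rpredB // dvdz_mulr.
- rewrite yP (P2_in_P1 xP) //.
  have -> : x = y + 2 * M%:Z * n%:Z by lia.
  by move: yP; rewrite mem_P1 // => /andP[_ dy]; rewrite rpredD // dvdz_mulr.
(* With both ends in [P2], [2N] divides [2Mn], so [N] divides [n] by coprimality, against
   [0 < n < N]. *)
- move: xP yP; rewrite !mem_P2 // => /andP[_ dx] /andP[_ dy].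
  have : (2 * N%:Z %| 2 * (M%:Z * n%:Z))%Z.
    by rewrite mulrA -E -(subrKA s) -(opprB _ s) rpredB.
  rewrite dvdz_mul2l //= Gauss_dvdzr ?coprimezE /= 1?coprime_sym //.
  by move=> /dvdn_leq; lia.
Qed.

Lemma weight_mulN (m : nat) : (0 < m < M)%N ->
  weight M N s (2 * N%:Z * m%:Z) = (M - m)%N.
Proof.
move=> mM; rewrite weightE.
apply: (@card_shift_progression _ _ _ _ s); rewrite -/(P2 M N s); first by lia.
  exact: fsubsetUr.
move=> x y /fsetUP[xP|xP] /fsetUP[yP|yP] E.
(* With both ends in [P1], coprimality makes [M] divide [m], against [0 < m < M]. *)
- move: xP yP; rewrite !mem_P1 // => /andP[_ dx] /andP[_ dy].
  have : (2 * M%:Z %| 2 * (N%:Z * m%:Z))%Z by rewrite mulrA -E rpredB.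
  rewrite dvdz_mul2l //= Gauss_dvdzr ?coprimezE //=.
  by move=> /dvdn_leq; lia.
- rewrite yP (P1_in_P2 xP) //.
  have -> : x - s = y - s + 2 * N%:Z * m%:Z by lia.
  by move: yP; rewrite mem_P2 // => /andP[_ dy]; rewrite rpredD // dvdz_mulr.
- rewrite xP (P1_in_P2 yP) //.
  have -> : y - s = x - s - 2 * N%:Z * m%:Z by lia.
  by move: xP; rewrite mem_P2 // => /andP[_ dx]; rewrite rpredB // dvdz_mulr.
- by rewrite xP.
Qed.

Lemma card_P1_P2_even : (2 %| s)%Z -> #|` P1 M N `&` P2 M N s| = 1%N.
Proof.
move=> /dvdzP[t st]; apply/eqP/cardfs1P.
have co : coprimez M%:Z N%:Z by rewrite coprimezE.
(* With [s = 2t], halving a common point gives [c] in [[0, MN)] with [c = 0] mod [M] and [c = t] mod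
   [N]. Reducing modulo [MN] preserves both congruences. *)
pose c := (zchinese M%:Z N%:Z 0 t %% (M%:Z * N%:Z))%Z.
have cM : (M%:Z %| c)%Z.
  apply: rpredB; last by rewrite dvdz_mull ?dvdz_mulr.
  by rewrite -[zchinese _ _ _ _]subr0 -eqz_mod_dvd; apply/eqP/zchinese_modl.
have cN : (N%:Z %| c - t)%Z.
  rewrite /c /modz addrAC; apply: rpredB; last by rewrite !dvdz_mull.
  by rewrite -eqz_mod_dvd; apply/eqP/zchinese_modr.
have c0 : 0 <= c by apply: modz_ge0; lia.
have c1 : c < M%:Z * N%:Z by apply: ltz_pmod; lia.
have cP : 2 * c \in P1 M N `&` P2 M N s.
  rewrite inE mem_P1 // mem_P2 // st (mulrC t) -mulrBr !dvdz_mul2l //= cM cN.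
  by rewrite !andbT; apply/andP; split; lia.
exists (2 * c); apply/fsetP => x; rewrite in_fset1.
apply/idP/eqP => [xP|-> //].
move: xP cP; rewrite !inE !mem_P1 // !mem_P2 //.
move=> /andP[/andP[xb xM] /andP[_ xN]] /andP[/andP[cb cM'] /andP[_ cN']].
apply: dvdz_eq_period => //; first by rewrite rpredB.
by rewrite -(subrKA s) -(opprB _ s) rpredB.
Qed.

(** Membership in [P1] fixes the residue modulo [2M]; membership of the shift in [P2] fixes it
    modulo [2N]. *)
Lemma cross_uniq (l x y : int) :
  x \in P1 M N -> x - l \in P2 M N s -> y \in P1 M N -> y - l \in P2 M N s -> x = y.
Proof.
rewrite !mem_P1 // !mem_P2 // => /andP[xb xM] /andP[_ xN] /andP[yb yM] /andP[_ yN].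
apply: dvdz_eq_period => //; first by rewrite rpredB.
have -> : x - y = (x - l - s) - (y - l - s) by ring.
by rewrite rpredB.
Qed.

Lemma card_cross (l : int) :
  #|` [fset x in P1 M N | x - l \in P2 M N s]| = (l \in LC_pos M N s).
Proof.
case: mem_LC_pos => [[x xP yP]|no].
  apply/eqP/cardfs1P; exists x; apply/fsetP => z; rewrite !inE /=.
  by apply/andP/eqP => [[zP wP]|->]; [apply: (cross_uniq zP wP) | split].
apply/eqP; rewrite cardfs_eq0; apply/eqP/fsetP => z; rewrite !inE /=.
by apply/negP => /andP[zP wP]; apply: no; exists z.
Qed.

Lemma card_crossN (l : int) :
  #|` [fset x in P2 M N s | x - l \in P1 M N]| = (- l \in LC_pos M N s).
Proof.
rewrite -card_cross.
have -> : [fset x in P2 M N s | x - l \in P1 M N] =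
          [fset x + l | x in [fset x in P1 M N | x - - l \in P2 M N s]].
  apply/fsetP => x; rewrite !inE /=; apply/andP/imfsetP.
    by case=> xP yP; exists (x - l); rewrite ?inE /= ?opprK subrK // xP yP.
  by case=> y; rewrite !inE /= opprK => /andP[yP xP] ->; rewrite addrK.
by rewrite card_imfset //=; exact: addIr.
Qed.

(** Two ends in the same sub-array would put [l] or [- l] in a self difference set. Every
    contributor is therefore mixed, of one of two kinds according to which end lies in [P1]. *)
Lemma weight_notin_LS (l : int) : l \notin LS M N ->
  weight M N s l = ((l \in LC_pos M N s) + (- l \in LC_pos M N s))%N.
Proof.
rewrite mem_LS !negb_or => /and4P[l1 l2 l3 l4].
have no1 x : x \in P1 M N -> x - l \in P1 M N -> False.
  rewrite P1E => xP yP; have := sub_progression xP yP.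
  by rewrite subKr (negbTE l1) (negbTE l2).
have no2 x : x \in P2 M N s -> x - l \in P2 M N s -> False.
  move=> xP yP; have := sub_progression xP yP.
  by rewrite subKr (negbTE l3) (negbTE l4).
rewrite weightE -card_cross -card_crossN -cardfsUI.
(* The two kinds are disjoint: a sensor of both kinds would have [x] and [x - l] in [P1]. *)
have -> : [fset x in P1 M N | x - l \in P2 M N s] `&`
          [fset x in P2 M N s | x - l \in P1 M N] = fset0.
  apply/fsetP => x; rewrite !inE /=; apply/negP => /andP[/andP[xP _] /andP[_ yP]].
  exact: no1 xP yP.
rewrite cardfs0 addn0; congr #|` _|; apply/fsetP => x; rewrite !inE /=.
have := no1 x; have := no2 x.
case: (x \in P1 _ _); case: (x \in P2 _ _ _); case: (x - l \in P1 _ _);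
  case: (x - l \in P2 _ _ _) => //= a b.
all: by first [case: (a isT isT) | case: (b isT isT)].
Qed.

Lemma weight_Lp (l : int) : l \notin LS M N -> l \in Lp M N s -> weight M N s l = 2%N.
Proof.
move=> lS; rewrite mem_Lp //; last by case/andP: sN.
by rewrite weight_notin_LS // => /andP[-> ->].
Qed.

(** In [LC] but outside [Lp], exactly one of [l] and [- l] lies in [LC_pos]. *)
Lemma weight_Lnp (l : int) : l \notin LS M N -> l \in Lnp M N s -> weight M N s l = 1%N.
Proof.
move=> lS; rewrite in_fsetD mem_LC mem_Lp //; last by case/andP: sN.
by rewrite weight_notin_LS //; do 2!case: (_ \in LC_pos _ _ _).
Qed.

End Array.

(** * The weight function for odd and even [s] *)

Theorem proposition3 (M N : nat) (s : int)
    (hM : (0 < M)%N) (hN : (0 < N)%N) (hMN : coprime M N)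
    (hs0 : 0 <= s) (hs1 : s <= 2 * N%:Z - 1) :
  (~~ (2 %| s)%Z ->
     [/\ (forall n : nat, (1 <= n <= N - 1)%N ->
            weight M N s (2 * M%:Z * n%:Z) = (N - n)%N /\
            weight M N s (- (2 * M%:Z * n%:Z)) = (N - n)%N),
         (forall m : nat, (1 <= m <= M - 1)%N ->
            weight M N s (2 * N%:Z * m%:Z) = (M - m)%N /\
            weight M N s (- (2 * N%:Z * m%:Z)) = (M - m)%N),
         weight M N s 0 = (M + N)%N,
         (forall l : int, l \in Lp M N s `\` [fset 0] -> weight M N s l = 2%N) &
         (forall l : int, l \in Lnp M N s -> weight M N s l = 1%N)])
  /\
  ((2 %| s)%Z ->
     [/\ (forall n : nat, (1 <= n <= N - 1)%N ->
            weight M N s (2 * M%:Z * n%:Z) = (N - n)%N /\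
            weight M N s (- (2 * M%:Z * n%:Z)) = (N - n)%N),
         (forall m : nat, (1 <= m <= M - 1)%N ->
            weight M N s (2 * N%:Z * m%:Z) = (M - m)%N /\
            weight M N s (- (2 * N%:Z * m%:Z)) = (M - m)%N),
         weight M N s 0 = (M + N - 1)%N,
         (forall l : int, l \in Lp M N s `\` LS M N -> weight M N s l = 2%N) &
         (forall l : int, l \in (LC M N s `\` Lp M N s) `\` LS M N ->
            weight M N s l = 1%N)]).
Proof.
have sN : 0 <= s < 2 * N%:Z by lia.
have wM n : (1 <= n <= N - 1)%N ->
    weight M N s (2 * M%:Z * n%:Z) = (N - n)%N /\
    weight M N s (- (2 * M%:Z * n%:Z)) = (N - n)%N.
  by move=> nN; rewrite weightN weight_mulM //; lia.
have wN m : (1 <= m <= M - 1)%N ->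
    weight M N s (2 * N%:Z * m%:Z) = (M - m)%N /\
    weight M N s (- (2 * N%:Z * m%:Z)) = (M - m)%N.
  by move=> mM; rewrite weightN weight_mulN //; lia.
split=> s2; split=> //.
- by rewrite weight0 // P1_P2_odd // cardfs0 subn0.
(* For odd [s], parity keeps cross differences out of [LS], so the count outside [LS] applies. *)
- move=> l /fsetDP[lp _]; apply: weight_Lp => //; apply: LC_odd_notin_LS s2 _.
  by move: lp; rewrite mem_Lp // mem_LC => /andP[->].
- move=> l lnp; apply: weight_Lnp => //; apply: LC_odd_notin_LS s2 _.
  by case/fsetDP: lnp.
- by rewrite weight0 // card_P1_P2_even.
- by move=> l /fsetDP[lp lS]; exact: weight_Lp.
- by move=> l /fsetDP[lnp lS]; exact: weight_Lnp.
Qed.
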